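(* Let $\alpha,\beta>0$ be real numbers. There exists an integer $K(\alpha,\beta)\geq1$ such that, for every integer $N\geq1$ and all $E_1,E_2\subseteq\mathbb{Z}_N$ satisfying $|E_1|\geq\alpha N$ and $|E_2|\geq\beta N$, there exists a (positive) divisor $d\mid N$ with $d\leq K(\alpha,\beta)$ such that $$d\mathbb{Z}_N\subseteq(E_1-E_1)^2-(E_2-E_2)^2.$$
   Context: $\mathbb{Z}_N=\mathbb{Z}/N\mathbb{Z}$ is the ring of integers modulo $N$. For $A,B\subseteq\mathbb{Z}_N$, $A-B=\{a-b:a\in A,\ b\in B\}$ and $A^2:=\{a^2:a\in A\}$ is the set of pointwise squares (not the product set). *)

(* Defs.v *)
From mathcomp Require Import all_boot all_order all_algebra.
From mathcomp Require Import reals.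

Set Implicit Arguments.
Unset Strict Implicit.
Unset Printing Implicit Defensive.

Import GRing.Theory.
Local Open Scope ring_scope.

(* The integers modulo N >= 1 are 'I_n.+1 with N = n.+1: its zmodType structure
   is addition modulo n.+1 and Zp_mul is multiplication modulo n.+1.  The ring
   type 'Z_N is unsuitable because 'Z_1 has two elements. *)

Definition diff_set (n : nat) (A B : {set 'I_n.+1}) : {set 'I_n.+1} :=
  [set a - b | a in A, b in B].

Definition square_set (n : nat) (A : {set 'I_n.+1}) : {set 'I_n.+1} :=
  [set Zp_mul a a | a in A].

Definition dilate_full (n d : nat) : {set 'I_n.+1} :=
  [set x *+ d | x : 'I_n.+1].

(* Main.v *)
Require Import Defs.
From mathcomp Require Import all_boot all_order all_algebra all_solvable
  all_field.
From mathcomp Require Import reals ring zify.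

(** The proof is Fourier analysis on Z_N x Z_N, based on the factorisation
    x^2 - y^2 = (x - y)(x + y).  For a unit r and a scale j < J, the pair
      x = L^j r + L^(J-j) t / r,    y = L^(J-j) t / r - L^j r
    satisfies x^2 - y^2 = 4 L^J t.  So if for every t some such pair lies in
    (E1 - E1) x (E2 - E2), all multiples of D = 4 L^J are differences of
    squares, and they form the ideal generated by d = gcd(D, N).

    Suppose that no such pair exists.  Expanding the number of solutions in
    additive characters and adding over the scales gives
      sum over (a, b) of |E1^(a)|^2 |E2^(b)|^2 T(a, b) = 0,
    where E^ is the Fourier transform of the indicator function of E, and
    T(a, b) is the sum over j of the Kloosterman sums
    S(L^j u, L^(J-j) v) with u = b - a, v = - (a + b) t.  The frequency (0, 0)
    contributes a main term, and the other terms cannot cancel it, for two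
    reasons.

    - Decay ([kloosterman_decay]): L can be chosen, independently of N, such
      that S(A, B) is small compared with the number of units of Z_N, unless
      L A = L B = 0.
    - Where decay fails, S(A, B) may be very negative (it is for A = N / 2,
      B = 0 when N is even), but if A = B = 0 it is positive.  For fixed (u, v)
      there are at most two scales j at which L kills both L^j u and L^(J-j) v
      while one of them is nonzero: the last j with L^j u <> 0 and the first j
      with L^(J-j) v <> 0.  Hence a bounded number J of scales makes their
      contribution negligible ([sum_kloosterman_ge]).

    For the decay, S(A, B) is reduced to the modulus M = N / gcd(A, B, N), which
    is large unless the factorial of a constant kills A and B.  When
    gcd(A, B, M) = 1, the substitution r -> s r shows that S takes the
    same value at the phi(M) distinct points (A s, B / s), so phi(M) S(A, B)^4
    is at most the sum of all fourth powers, which is M^2 times the number of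
    unit quadruples with r1 + r2 + r3 + r4 = 0 and
    1/r1 + 1/r2 + 1/r3 + 1/r4 = 0.  These equations imply
    (r1 + r2)(r1 + r3)(r2 + r3) = 0 modulo M, so that one of the three factors
    has a common divisor with M of size at least M^(1/3); by the divisor bound
    this is rare. *)

Set Implicit Arguments.
Unset Strict Implicit.
Unset Printing Implicit Defensive.

Import Order.TTheory GRing.Theory Num.Theory.

(** * The divisor bound and Euler's function *)

(** A divisor [d] of [a * b] is the product of [gcdn d a], which divides [a],
    and of its cofactor, which divides [b]. *)
Lemma size_divisorsM (a b : nat) :
  0 < a -> 0 < b ->
  size (divisors (a * b)) <= size (divisors a) * size (divisors b).
Proof.
move=> a_gt0 b_gt0; have ab_gt0 : 0 < a * b by rewrite muln_gt0 a_gt0.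
rewrite -(size_allpairs muln); apply: uniq_leq_size; first exact: divisors_uniq.
move=> d; rewrite -dvdn_divisors // => d_ab.
have d_gt0 : 0 < d := dvdn_gt0 ab_gt0 d_ab.
have g_gt0 : 0 < gcdn d a by rewrite gcdn_gt0 d_gt0.
apply/allpairsP; exists (gcdn d a, d %/ gcdn d a) => /=; split.
- by rewrite -dvdn_divisors // dvdn_gcdr.
- rewrite -dvdn_divisors // -(dvdn_pmul2l g_gt0) mulnC divnK ?dvdn_gcdl //.
  by rewrite muln_gcdl dvdn_gcd d_ab dvdn_mulr.
- by rewrite mulnC divnK ?dvdn_gcdl.
Qed.

Lemma size_divisors_pfactor (p k : nat) :
  prime p -> size (divisors (p ^ k)) <= k.+1.
Proof.
move=> p_pr; rewrite -[k.+1](size_iota 0) -[X in _ <= X](size_map (expn p)).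
apply: uniq_leq_size; first exact: divisors_uniq.
move=> d; rewrite -dvdn_divisors ?expn_gt0 ?prime_gt0 //.
by case/(dvdn_pfactor _ _ p_pr) => i le_ik ->; rewrite map_f // mem_iota.
Qed.

(** The exponential wins because [k.+1 <= m * 2 ^ (k %/ m)], which is then
    raised to the power [m]. *)
Lemma succ_expn_le (m k : nat) : 0 < m -> k.+1 ^ m <= m ^ m * 2 ^ k.
Proof.
move=> m_gt0.
have le1 : k.+1 <= m * 2 ^ (k %/ m).
  apply: leq_trans (_ : m * (k %/ m).+1 <= _).
    by rewrite mulnC ltn_ceil.
  by rewrite leq_mul2l ltn_expl ?orbT.
apply: leq_trans (_ : (m * 2 ^ (k %/ m)) ^ m <= _); first by rewrite leq_exp2r.
by rewrite expnMn leq_mul2l -expnM leq_exp2l // leq_divM orbT.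
Qed.

(** The bound on the number of divisors by any small power of [M].  Removing
    the full [p]-part [p ^ k] of [M] divides the left-hand side by at most
    [k.+1 ^ m].  For [p >= 2 ^ m] this is at most [p ^ k]; each of the finitely
    many smaller primes costs an additional factor [m ^ m], at most once. *)
Lemma size_divisors_expn_le (m : nat) :
  exists2 C, 0 < C & forall M, 0 < M -> size (divisors M) ^ m <= C * M.
Proof.
case: (posnP m) => [-> | m_gt0].
  by exists 1 => // M M_gt0; rewrite expn0 mul1n.
pose c := m ^ m; pose B := 2 ^ m.
have c_gt0 : 0 < c by rewrite expn_gt0 m_gt0.
pose W M := \prod_(p < B | prime p && (p %| M)) c.
exists (\prod_(p < B) c) => [|M M_gt0]; first by rewrite prodn_gt0.
apply: leq_trans (_ : W M * M <= _); last first.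
  rewrite leq_mul2r /W big_mkcond leq_prod ?orbT // => p _.
  by case: ifP.
have [n] := ubnP M; elim: n M M_gt0 => // n IHn M M_gt0 le_Mn.
case: (ltngtP M 1) => [||->];
  [by case: M M_gt0 {le_Mn} | move=> M_gt1 |]; last first.
  have -> : size (divisors 1) = 1 by [].
  by rewrite exp1n muln_gt0 prodn_gt0 // => p; case: ifP.
have [p p_pr p_M] := pdivP M_gt1.
have [M' pM' defM] := pfactor_coprime p_pr M_gt0.
set k := logn p M in defM.
have M'_gt0 : 0 < M' by case: (posnP M') M_gt0 => // M'0; rewrite defM M'0.
have k_gt0 : 0 < k by rewrite logn_gt0 mem_primes p_pr M_gt0.
have pk_gt1 : 1 < p ^ k by rewrite -(exp1n k) ltn_exp2r // prime_gt1.
have lt_M'n : M' < n.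
  rewrite -ltnS (leq_trans _ le_Mn) // defM !ltnS -[X in X < _]muln1.
  by rewrite ltn_pmul2l.
have p_M' : ~~ (p %| M') by rewrite -prime_coprime.
have le_div : size (divisors M) ^ m <= k.+1 ^ m * size (divisors M') ^ m.
  rewrite -expnMn leq_exp2r // mulnC.
  apply: leq_trans (_ : size (divisors M') * size (divisors (p ^ k)) <= _).
    by rewrite {1}defM size_divisorsM // ltnW.
  by rewrite leq_mul2l size_divisors_pfactor ?orbT.
apply: leq_trans le_div _.
apply: leq_trans (leq_mul (leqnn _) (IHn M' M'_gt0 lt_M'n)) _.
have W_M' (q : 'I_B) : prime q && (q %| M') -> prime q && (q %| M).
  by case/andP => -> /=; rewrite defM; apply: dvdn_mulr.
have [lt_pB | le_Bp] := ltnP p B.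
  (* [W] loses the factor [c] of the prime [p] when [p ^ k] is removed. *)
  have leW : c * W M' <= W M.
    rewrite /W [X in _ <= X](bigD1 (Ordinal lt_pB)) /= ?p_pr ?p_M //.
    rewrite leq_mul2l; apply/orP; right.
    rewrite big_mkcond [X in _ <= X]big_mkcond leq_prod // => q _.
    have [/andP[q_pr q_M']|_] := boolP (prime q && (q %| M')); last first.
      by case: ifP.
    rewrite q_pr defM dvdn_mulr //= -val_eqE /=.
    by case: eqP => // qp; rewrite -qp q_M' in p_M'.
  apply: leq_trans (_ : c * W M' * M <= _); last by rewrite leq_mul2r leW orbT.
  apply: leq_trans (_ : (c * 2 ^ k) * (W M' * M') <= _).
    by rewrite leq_mul2r succ_expn_le ?orbT.
  rewrite [X in _ <= _ * X]defM -!mulnA leq_mul2l; apply/orP; right.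
  rewrite mulnCA leq_mul2l; apply/orP; right; rewrite mulnC leq_mul2l.
  by rewrite leq_exp2r ?prime_gt1 // orbT.
have leW : W M' <= W M.
  rewrite /W big_mkcond [X in _ <= X]big_mkcond leq_prod // => q _.
  by case: ifP => [/W_M' ->|_] //; case: ifP.
rewrite mulnC -mulnA; apply: leq_mul => //; rewrite [X in _ <= X]defM leq_mul2l.
apply/orP; right; apply: leq_trans (_ : (2 ^ k) ^ m <= _).
  by rewrite leq_exp2r // ltn_expl.
by rewrite -expnM mulnC expnM leq_exp2r.
Qed.

(** The primes of [M] that do not divide [c] are put into the multiple of [d]
    that is added to [c]; those that divide [c] do not divide [d]. *)
Lemma coprime_lift (d M c : nat) :
  0 < M -> d %| M -> coprime c d -> exists2 x, x = c %[mod d] & coprime x M.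
Proof.
move=> M_gt0 d_M cd; pose k := \prod_(p <- primes M | ~~ (p %| c)) p.
have c_or_d p : prime p -> p %| c -> p %| d -> False.
  move=> p_pr pc pd; have : p %| gcdn c d by rewrite dvdn_gcd pc.
  by rewrite (eqP cd) dvdn1; apply/negP; rewrite neq_ltn prime_gt1 ?orbT.
exists (c + k * d); first by rewrite addnC modnMDl.
have [|g_gt1] := leqP (gcdn (c + k * d) M) 1.
  by rewrite /coprime eqn_leq gcdn_gt0 M_gt0 orbT andbT.
have [p p_pr] := pdivP g_gt1; rewrite dvdn_gcd => /andP[p_x p_M].
have p_M' : p \in primes M by rewrite mem_primes p_pr M_gt0.
have [p_c | p_c] := boolP (p %| c); last first.
  move: p_x; rewrite dvdn_addl ?(negPf p_c) //.
  by rewrite /k (big_rem p) //= p_c dvdn_mulr // dvdn_mulr.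
move: p_x; rewrite dvdn_addr // Euclid_dvdM // => /orP[]; last first.
  by move/(c_or_d _ p_pr p_c).
rewrite /k Euclid_dvd_prod // big_has_cond => /hasP[q q_M] /andP[q_c] p_q.
move: q_M p_q; rewrite mem_primes => /and3P[q_pr _ _].
by rewrite dvdn_prime2 // => /eqP epq; rewrite -epq p_c in q_c.
Qed.

(** Reduction maps the units modulo [M] onto the units modulo [d]. *)
Lemma totient_dvd_leq (d M : nat) : 0 < M -> d %| M -> totient d <= totient M.
Proof.
move=> M_gt0 d_M; have d_gt0 := dvdn_gt0 M_gt0 d_M.
pose U m := [set c : 'I_m | coprime m c].
have cardU m : totient m = #|U m|.
  rewrite totient_count_coprime big_mkord -sum1_card [RHS]big_mkcond /=.
  by apply: eq_bigr => c _; rewrite inE; case: coprime.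
have liftP (c : 'I_d) : exists x : 'I_M, (c \in U d) ==>
  ((x \in U M) && (x == c %[mod d])).
  have [|_] := boolP (c \in U d); last by exists (Ordinal M_gt0).
  rewrite inE coprime_sym => /(coprime_lift M_gt0 d_M)[x x_c x_M].
  exists (Ordinal (ltn_pmod x M_gt0)); rewrite inE /= coprime_sym coprime_modl.
  by rewrite x_M (modn_dvdm _ d_M) x_c eqxx.
have /fin_all_exists[f fP] := liftP.
rewrite !cardU -(card_in_imset (f := f)) => [|c c' cU c'U ff].
  apply/subset_leq_card/subsetP => _ /imsetP[c cU ->].
  by have /implyP/(_ cU)/andP[] := fP c.
have /implyP/(_ cU)/andP[_] := fP c; have /implyP/(_ c'U)/andP[_] := fP c'.
by rewrite ff => /eqP ->; rewrite !modn_small ?ltn_ord // => /eqP/val_inj.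
Qed.

(** From [M = \sum_(d %| M) totient d], each term being at most [totient M]. *)
Lemma leq_totient_divisors (M : nat) :
  0 < M -> M <= totient M * size (divisors M).
Proof.
move=> M_gt0; rewrite -[X in X <= _]sum_totient_dvd.
apply: leq_trans (_ : \sum_(d < M.+1 | d %| M) totient M <= _).
  by apply: leq_sum => d; apply: totient_dvd_leq.
rewrite sum_nat_const mulnC leq_mul2l; apply/orP; right.
rewrite cardE -(size_map val); apply: uniq_leq_size.
  by rewrite map_inj_uniq ?enum_uniq //; apply: val_inj.
by move=> _ /mapP[d d_M ->]; rewrite -dvdn_divisors //; rewrite mem_enum in d_M.
Qed.

(** * Residues sharing a large divisor with the modulus *)

(** The condition is [gcdn x M >= M ^ (1/3)]; the exponent 1/3 is what a
    vanishing product of three residues guarantees for one of them. *)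
Definition large_gcd (M : nat) : {set 'I_M} :=
  [set x : 'I_M | M <= gcdn x M ^ 3].

(** The set is covered by the multiples of the divisors [d >= M ^ (1/3)] of [M],
    and each of these divisors has at most [M ^ (2/3)] multiples. *)
Lemma card_large_gcd (M : nat) :
  0 < M -> #|large_gcd M| ^ 3 <= size (divisors M) ^ 3 * M ^ 2.
Proof.
move=> M_gt0; pose large d := (d %| M) && (M <= d ^ 3).
pose m := \max_(d < M.+1 | large d) (M %/ d).
have m3 : m ^ 3 <= M ^ 2.
  rewrite /m; apply: (big_ind (fun m => m ^ 3 <= M ^ 2)) => // [x y|d].
    by rewrite /maxn; case: ifP.
  case/andP=> d_M M_d3; rewrite -(leq_pmul2r M_gt0) -expnSr.
  apply: leq_trans (_ : (M %/ d) ^ 3 * d ^ 3 <= _).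
    by rewrite leq_mul2l M_d3 orbT.
  by rewrite -expnMn divnK.
suff le_m : #|large_gcd M| <= size (divisors M) * m.
  apply: leq_trans (_ : (size (divisors M) * m) ^ 3 <= _).
    by rewrite leq_exp2r.
  by rewrite expnMn leq_mul2l m3 orbT.
pose mul d : {set 'I_M} := [set x : 'I_M | d %| x].
have card_mul d : d %| M -> #|mul d| <= M %/ d.
  move=> d_M; have d_gt0 := dvdn_gt0 M_gt0 d_M.
  pose f (x : 'I_M) : 'I_(M %/ d).+1 := inord (x %/ d).
  have f_val (x : 'I_M) : f x = x %/ d :> nat.
    by rewrite inordK // ltnS leq_div2r // ltnW.
  rewrite -[X in _ <= X]card_ord -(card_in_imset (f := f)) => [|x y].
    rewrite -[X in _ <= X](card_imset (f := widen_ord (leqnSn _))).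
      apply/subset_leq_card/subsetP => _ /imsetP[x x_d ->].
      have lt_x : x %/ d < M %/ d by rewrite ltn_divLR // divnK.
      by apply/imsetP; exists (Ordinal lt_x) => //; apply: val_inj;
        rewrite /= f_val.
    by move=> u v /(congr1 val) /= uv; apply: val_inj.
  rewrite !inE => x_d y_d /(congr1 (@nat_of_ord _)); rewrite !f_val => xy.
  by apply: val_inj; rewrite /= -(divnK x_d) xy divnK.
apply: leq_trans (_ : #|\bigcup_(d < M.+1 | large d) mul d| <= _).
  apply/subset_leq_card/subsetP => x; rewrite inE => x_l.
  have g_M : gcdn x M < M.+1 by rewrite ltnS dvdn_leq // dvdn_gcdr.
  apply/bigcupP; exists (Ordinal g_M); first by rewrite /large dvdn_gcdr.
  by rewrite inE dvdn_gcdl.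
apply: leq_trans (_ : \sum_(d < M.+1 | large d) m <= _).
  apply: leq_trans (_ : \sum_(d < M.+1 | large d) #|mul d| <= _).
    apply: (big_rec2 (fun (A : {set 'I_M}) n => #|A| <= n)).
      by rewrite cards0.
    move=> d n A _ le_An; apply: leq_trans (leq_card_setU _ _) _.
    by rewrite leq_add2l.
  apply: leq_sum => d lg; have /andP[d_M _] := lg.
  by apply: leq_trans (card_mul _ d_M) _; apply: leq_bigmax_cond.
rewrite sum_nat_const leq_mul2r; apply/orP; right.
rewrite cardE -(size_map val); apply: uniq_leq_size.
  by rewrite map_inj_uniq ?enum_uniq //; apply: val_inj.
move=> _ /mapP[d d_l ->]; rewrite -dvdn_divisors //.
by move: d_l; rewrite mem_enum => /andP[].
Qed.

Local Open Scope ring_scope.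

(** [M] divides the product of the three common divisors with [M], so that these
    cannot all be less than [M ^ (1/3)]. *)
Lemma mul3_eq0_large_gcd (m : nat) (x y z : 'I_m.+2) : x * y * z = 0 ->
  [|| x \in large_gcd m.+2, y \in large_gcd m.+2 | z \in large_gcd m.+2].
Proof.
move=> xyz0; have : (m.+2 %| x * y * z)%N.
  by move/(congr1 val): xyz0 => /= /eqP; rewrite modnMml.
set M := m.+2 => M_xyz; rewrite !inE.
pose g (t : 'I_M) := gcdn t M.
have g_gt0 t : (0 < g t)%N by rewrite gcdn_gt0 orbT.
have M_g : (M <= g x * g y * g z)%N.
  apply: dvdn_leq; first by rewrite !muln_gt0 !g_gt0.
  have gM a b : (M %| a * b)%N -> (M %| gcdn a M * b)%N.
    by rewrite muln_gcdl dvdn_gcd => ->; rewrite dvdn_mulr.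
  rewrite mulnC; apply: (gM); rewrite mulnC.
  rewrite -mulnA; apply: (gM); rewrite mulnCA; apply: (gM).
  by rewrite mulnCA mulnA.
have [//|/= lt_x] := leqP M (gcdn x M ^ 3).
have [//|/= lt_y] := leqP M (gcdn y M ^ 3).
rewrite leqNgt; apply/negP => lt_z.
have := ltn_mul (ltn_mul lt_x lt_y) lt_z.
have -> : (M * M * M = M ^ 3)%N by rewrite !expnS expn0 muln1 mulnA.
by rewrite -!expnMn ltn_exp2r // ltnNge M_g.
Qed.

(** By [mul3_eq0_large_gcd] one of the three pairwise sums is in [large_gcd M];
    that sum and two of the variables determine the triple. *)
Lemma card_triple_sum_zero (m : nat) (M := m.+2) :
  (#|[set r : 'I_m.+2 * 'I_m.+2 * 'I_m.+2 |
      ((r.1.1 + r.1.2) * (r.1.1 + r.2) * (r.1.2 + r.2) == 0)%R]|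
    <= 3 * (M ^ 2 * #|large_gcd M|))%N.
Proof.
pose Z := 'I_m.+2; pose T := (Z * Z * Z)%type.
have card_pre (f : T -> T) : injective f ->
    (#|[set r | (f r).2 \in large_gcd M]| <= M ^ 2 * #|large_gcd M|)%N.
  move=> f_inj; rewrite -(card_imset _ f_inj).
  apply: (@leq_trans #|setX [set: Z * Z] (large_gcd M)|).
    apply/subset_leq_card/subsetP => _ /imsetP[r r_l ->].
    by rewrite !inE in r_l *.
  by rewrite cardsX cardsT card_prod card_ord mulnn.
pose f1 (r : T) : T := (r.1.2, r.2, r.1.1 + r.1.2).
pose f2 (r : T) : T := (r.1.2, r.2, r.1.1 + r.2).
pose f3 (r : T) : T := (r.1.1, r.2, r.1.2 + r.2).
have f1I : injective f1.
  move=> [[a b] c] [[a' b'] c'] /pair_equal_spec[/pair_equal_spec[/= -> ->]].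
  by move/addIr ->.
have f2I : injective f2.
  move=> [[a b] c] [[a' b'] c'] /pair_equal_spec[/pair_equal_spec[/= -> ->]].
  by move/addIr ->.
have f3I : injective f3.
  move=> [[a b] c] [[a' b'] c'] /pair_equal_spec[/pair_equal_spec[/= -> ->]].
  by move/addIr ->.
rewrite !mulSn mul0n addn0.
apply: leq_trans (leq_add (card_pre _ f1I)
                          (leq_add (card_pre _ f2I) (card_pre _ f3I))).
apply: leq_trans (leq_add (leqnn _) (leq_card_setU _ _)).
apply: leq_trans (leq_card_setU _ _); apply/subset_leq_card/subsetP => r.
by rewrite inE => /eqP/mul3_eq0_large_gcd; rewrite !inE.
Qed.

(** * Character sums on pairs of residues *)

(** If e1, e2, e3 are the elementary symmetric functions of [a], [b], [c], the
    product is [e1 * e2 - e3].  The sum of the inverses times [a * b * c * d] is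
    [e2 * d + e3], and [d = - e1]. *)
Lemma unit_quadruple_factor (R : comUnitRingType) (a b c d : R) :
  a \is a GRing.unit -> b \is a GRing.unit ->
  c \is a GRing.unit -> d \is a GRing.unit ->
  a + b + (c + d) = 0 -> a^-1 + b^-1 + (c^-1 + d^-1) = 0 ->
  (a + b) * (a + c) * (b + c) = 0.
Proof.
move=> Ua Ub Uc Ud sum0 inv0.
have -> : (a + b) * (a + c) * (b + c)
  = (a + b + (c + d)) * (a * b + b * c + c * a)
    - (b * c * d * 1 + a * c * d * 1 + (a * b * d * 1 + a * b * c * 1)) by ring.
rewrite -{1}(divrr Ua) -{1}(divrr Ub) -{1}(divrr Uc) -{1}(divrr Ud) sum0.
have -> : b * c * d * (a / a) + a * c * d * (b / b)
    + (a * b * d * (c / c) + a * b * c * (d / d))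
  = a * b * c * d * (a^-1 + b^-1 + (c^-1 + d^-1)) by ring.
by rewrite inv0 mulr0 mul0r subr0.
Qed.

Section Characters.

Variables (m : nat) (z : algC).
Hypothesis z_prim : m.+2.-primitive_root z.
Local Notation Z := 'I_m.+2.
Local Notation M := m.+2.

Definition addchar (x : Z) : algC := z ^+ x.

Lemma addcharD x y : addchar (x + y) = addchar x * addchar y.
Proof. by rewrite /addchar /= prim_expr_mod // exprD. Qed.

Lemma addchar0 : addchar 0 = 1.
Proof. by rewrite /addchar expr0. Qed.

Lemma conj_addchar x : (addchar x)^* = addchar (- x).
Proof.
have z1 : `|z| = 1.
  apply/eqP; rewrite -(@pexpr_eq1 _ _ M) // -normrX.
  by rewrite prim_expr_order // normr1.
have e1 : addchar x * addchar (- x) = 1 by rewrite -addcharD subrr addchar0.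
have ee : addchar x * (addchar x)^* = 1 by rewrite -normCK normrX z1 !expr1n.
by rewrite -[RHS]mulr1 -ee mulrCA mulrA e1 mul1r.
Qed.

(** For [x != 0], shifting [a] by 1 multiplies the sum by [addchar x != 1]. *)
Lemma sum_addchar x : \sum_a addchar (a * x) = if x == 0 then M%:R else 0.
Proof.
have [-> | x_neq0] := eqVneq x 0.
  under eq_bigr do rewrite mulr0 addchar0.
  by rewrite sumr_const card_ord.
have x1 : addchar x != 1.
  rewrite -(prim_order_dvd z_prim) gtnNdvd ?ltn_ord // lt0n.
  by apply: contraNneq x_neq0 => x0; apply/eqP/val_inj.
apply: (mulfI (x := addchar x - 1)); first by rewrite subr_eq0.
rewrite mulr0 mulrBl mul1r; apply/eqP; rewrite subr_eq0; apply/eqP.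
rewrite [RHS](reindex_inj (addIr 1)) mulr_sumr; apply: eq_bigr => a _ /=.
by rewrite mulrDl mul1r addcharD mulrC.
Qed.

(** The Fourier transform at the frequency [(a, b)] of the points
    [(x i, y i)], counted with multiplicity.  With a general index type,
    products of such sums are again of this form, so that [sum_charsum] is the
    only orthogonality relation needed to count solutions. *)
Definition charsum (I : finType) (P : pred I) (x y : I -> Z) (a b : Z) : algC :=
  \sum_(i | P i) addchar (a * x i + b * y i).

Lemma sum_charsum (I : finType) (P : pred I) (x y : I -> Z) :
  \sum_a \sum_b charsum P x y a b
  = (M ^ 2 * #|[set i | [&& P i, x i == 0 & y i == 0]]|)%:R.
Proof.
under eq_bigr do rewrite exchange_big; rewrite exchange_big /=.
rewrite (eq_bigr (fun i => if (x i == 0) && (y i == 0) then (M ^ 2)%:R else 0)).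
  rewrite -big_mkcondr sumr_const natrM mulr_natr; congr (_ *+ _).
  by apply: eq_card => i; rewrite inE.
move=> i _.
transitivity ((\sum_a addchar (a * x i)) * (\sum_b addchar (b * y i))).
  rewrite mulr_suml; apply: eq_bigr => a _; rewrite mulr_sumr.
  by apply: eq_bigr => b _; rewrite addcharD.
rewrite !sum_addchar; do 2!case: eqP => _; rewrite ?mulr0 ?mul0r //.
by rewrite -natrM mulnn.
Qed.

Lemma charsumM (I J : finType) (P : pred I) (Q : pred J) x y x' y' a b :
  charsum P x y a b * charsum Q x' y' a b =
  charsum (fun p : I * J => P p.1 && Q p.2) (fun p => x p.1 + x' p.2)
          (fun p => y p.1 + y' p.2) a b.
Proof.
rewrite /charsum big_distrlr pair_big /=; apply: eq_bigr => p _.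
by rewrite -addcharD; congr addchar; ring.
Qed.

Lemma conj_charsum (I : finType) (P : pred I) x y a b :
  (charsum P x y a b)^* = charsum P (fun i => - x i) (fun i => - y i) a b.
Proof.
rewrite rmorph_sum; apply: eq_bigr => i _.
by rewrite /= conj_addchar; congr addchar; ring.
Qed.

Definition unitZ : pred Z := fun r => r \is a GRing.unit.

Definition kloosterman (a b : Z) : algC :=
  charsum unitZ id (fun r => r^-1) a b.

(** Replace [r] by [- r]. *)
Lemma conj_kloosterman a b : (kloosterman a b)^* = kloosterman a b.
Proof.
rewrite /kloosterman conj_charsum /charsum [RHS](reindex_inj oppr_inj) /=.
apply: eq_big => [r|r _]; first by rewrite /unitZ unitrN.
by rewrite invrN.
Qed.

Lemma kloosterman_real a b : kloosterman a b \is Num.real.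
Proof. by apply/CrealP; rewrite conj_kloosterman. Qed.

Lemma kloosterman0 : kloosterman 0 0 = #|unitZ|%:R.
Proof.
rewrite /kloosterman /charsum.
by under eq_bigr do rewrite !mul0r addr0 addchar0; rewrite sumr_const.
Qed.

Lemma norm_addchar x : `|addchar x| = 1.
Proof.
apply/eqP; rewrite -(@pexpr_eq1 _ _ 2) // normCK conj_addchar.
by rewrite -addcharD subrr addchar0.
Qed.

Lemma norm_kloosterman_le a b : `|kloosterman a b| <= #|unitZ|%:R.
Proof.
apply: le_trans (ler_norm_sum _ _ _) _.
by under eq_bigr do rewrite norm_addchar; rewrite sumr_const.
Qed.

(** Replace [r] by [s * r].  This symmetry makes a large value of the sum occur
    at many frequencies. *)
Lemma kloosterman_scale s a b : s \is a GRing.unit ->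
  kloosterman (a * s) (b * s^-1) = kloosterman a b.
Proof.
move=> Us; rewrite /kloosterman /charsum [RHS](reindex_inj (mulrI Us)) /=.
apply: eq_big => [r|r Ur]; first by rewrite /unitZ unitrMr.
by rewrite invrM // !mulrA (mulrAC b).
Qed.

(** By orthogonality the fourth powers add up to [M ^ 2] times the number of
    quadruples of units with vanishing sum and vanishing sum of inverses; the
    fourth entry of such a quadruple is determined by the other three. *)
Lemma kloosterman_fourth_moment :
  \sum_a \sum_b kloosterman a b ^+ 4 <=
  (M ^ 2 * (3 * (M ^ 2 * #|large_gcd M|)))%:R.
Proof.
under eq_bigr do under eq_bigr do
  rewrite !exprS expr0 mulr1 mulrA !charsumM.
rewrite sum_charsum ler_nat leq_mul2l; apply/orP; right.
apply: leq_trans (card_triple_sum_zero m).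
pose f (i : Z * Z * (Z * Z)) : Z * Z * Z := (i.1.1, i.1.2, i.2.1).
rewrite -(card_in_imset (f := f)) => [|[[a b] [c d]] [[a' b'] [c' d']]].
  apply/subset_leq_card/subsetP => _ /imsetP[[[a b] [c d]] + ->].
  rewrite !inE /unitZ /= => /andP[/and3P[/andP[Ua Ub] Uc Ud]].
  by case/andP=> /eqP s0 /eqP i0; apply/eqP; apply: unit_quadruple_factor i0.
rewrite !inE /= => /and3P[_ /eqP s0 _] /and3P[_ /eqP s0' _].
move/pair_equal_spec=> [/pair_equal_spec[/= ea eb] /= ec].
move: s0'; rewrite -s0 -ea -eb -ec => /addrI/addrI ed.
by rewrite ea eb ec ed.
Qed.

(** The coprimality makes the frequencies [(a * s, b / s)], for [s] a unit,
    pairwise distinct, so the fourth power of the sum is counted that many times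
    in the fourth moment, whose other terms are nonnegative because the sums are
    real. *)
Lemma kloosterman_coprime_bound (a b : Z) : coprime (gcdn a b) M ->
  #|unitZ|%:R * kloosterman a b ^+ 4 <=
  (M ^ 2 * (3 * (M ^ 2 * #|large_gcd M|)))%:R.
Proof.
move=> ab_M; apply: le_trans kloosterman_fourth_moment.
have K4_ge0 a' b' : 0 <= kloosterman a' b' ^+ 4.
  by rewrite (exprM _ 2 2) real_exprn_even_ge0 // realX // kloosterman_real.
rewrite pair_big /= -sumr_const mulr_suml.
pose orb (s : Z) := (a * s, b * s^-1).
have orbI : {in unitZ &, injective orb}.
  move=> s t Us Ut /pair_equal_spec[/= as_at bs_bt].
  have bt_bs : b * t = b * s.
    by rewrite -[b in LHS](divrK Us) bs_bt mulrAC divrK.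
  have dvd_diff (c : Z) : c * s = c * t -> (M %| c * (s - t)%R)%N.
    by move/eqP; rewrite -subr_eq0 -mulrBr => /eqP/(congr1 val)/= /eqP.
  have: (M %| gcdn a b * (s - t)%R)%N.
    by rewrite muln_gcdl dvdn_gcd !dvd_diff.
  rewrite mulnC Gauss_dvdl 1?coprime_sym // /dvdn modn_small //.
  by move/eqP=> st0; apply/eqP; rewrite -subr_eq0; apply/eqP/val_inj.
have -> : \sum_(s in unitZ) 1 * kloosterman a b ^+ 4 =
    \sum_(p in orb @: unitZ) kloosterman p.1 p.2 ^+ 4.
  rewrite big_imset //=; apply: eq_bigr => s Us.
  by rewrite mul1r kloosterman_scale.
rewrite big_mkcond; apply: ler_sum => p _; case: ifP => // _; apply: K4_ge0.
Qed.

End Characters.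

(** * Decay of Kloosterman sums *)

Lemma unitZE (m : nat) (x : 'I_m.+2) : unitZ x = coprime m.+2 x.
Proof. by rewrite -[in LHS](natr_Zp x) /unitZ (@unitZpE m.+2). Qed.

Lemma card_unitZ (m : nat) : #|@unitZ m| = totient m.+2.
Proof.
rewrite totient_count_coprime big_mkord -sum1_card big_mkcond /=.
by apply: eq_bigr => c _; rewrite -topredE /= unitZE; case: coprime.
Qed.

(** The summand depends only on [r] modulo [m.+2], and the units modulo [n.+2]
    cover the units modulo [m.+2] evenly.  Instead of counting the fibres, the
    sum over all pairs formed by a unit [r] of the large ring and a unit [s] of
    the small ring is evaluated in two ways, translating by a lift of [s] or by
    the reduction of [r]. *)
Lemma kloosterman_reduction (n m g : nat) (z : algC) (A B : 'I_n.+2)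
    (A' B' : 'I_m.+2) :
  n.+2.-primitive_root z -> (n.+2 = g * m.+2)%N ->
  A = (g * A')%N :> nat -> B = (g * B')%N :> nat ->
  #|@unitZ m|%:R * kloosterman z A B
  = #|@unitZ n|%:R * kloosterman (z ^+ g) A' B'.
Proof.
move=> z_prim Ng AE BE.
have M_N : (m.+2 %| n.+2)%N by rewrite Ng dvdn_mull.
pose pr (x : 'I_n.+2) : 'I_m.+2 := inZp x.
have prM x y : pr (x * y) = pr x * pr y.
  by apply: val_inj; rewrite /= modn_dvdm // modnMm.
have pr1 : pr 1 = 1 by apply: val_inj.
have prU x : unitZ x -> unitZ (pr x).
  move=> Ux; apply/unitrP; exists (pr x^-1).
  by rewrite -!prM mulVr // mulrV // pr1.
have prV x : unitZ x -> pr x^-1 = (pr x)^-1.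
  move=> Ux; apply: (mulrI (prU _ Ux)).
  by rewrite -prM !mulrV ?pr1 //; apply: prU.
have w_prim : m.+2.-primitive_root (z ^+ g).
  have gE : (n.+2 %/ m.+2 = g)%N by rewrite Ng mulnK.
  by rewrite -gE; apply: dvdn_prim_root.
pose F s := addchar (z ^+ g) (A' * s + B' * s^-1).
have FE r : unitZ r -> addchar z (A * r + B * r^-1) = F (pr r).
  move=> Ur; rewrite /F -prV // !(addcharD z_prim, addcharD w_prim).
  have expE (c : 'I_n.+2) (c' : 'I_m.+2) x : c = (g * c')%N :> nat ->
      addchar z (c * x) = addchar (z ^+ g) (c' * pr x).
    move=> cE; rewrite /addchar /= (prim_expr_mod z_prim).
    by rewrite modnMmr (prim_expr_mod w_prim) -exprM cE mulnA.
  by rewrite (expE _ _ _ AE) (expE _ _ _ BE).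
have lift s : exists t : 'I_n.+2, unitZ s ==> unitZ t && (pr t == s).
  have [Us|] := boolP (unitZ s); last by exists 0.
  rewrite unitZE coprime_sym in Us.
  have [t t_s t_N] := coprime_lift (ltn0Sn _) M_N Us.
  exists (inZp t); rewrite unitZE /= coprime_sym coprime_modl t_N -val_eqE /=.
  by rewrite modn_dvdm // t_s modn_small.
have /fin_all_exists[f fP] := lift.
have f_unit s : unitZ s -> unitZ (f s).
  by move=> Us; have := fP s; rewrite Us => /andP[].
have fK s : unitZ s -> pr (f s) = s.
  by move=> Us; have := fP s; rewrite Us => /andP[_ /eqP].
have KE : kloosterman z A B = \sum_(r | unitZ r) F (pr r).
  by apply: eq_bigr => r; apply: FE.
transitivity (\sum_(s | unitZ s) \sum_(r | unitZ r) F (pr r * s)).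
  rewrite mulr_natl -sumr_const; apply: eq_big => // s Us.
  rewrite KE (reindex_inj (mulIr (f_unit _ Us))) /=; apply: eq_big => [r|r _].
    by rewrite /unitZ unitrMl //; apply: f_unit.
  by rewrite prM fK.
rewrite exchange_big mulr_natl -sumr_const; apply: eq_big => //= r Ur.
rewrite /kloosterman /charsum [RHS](reindex_inj (mulrI (prU _ Ur))) /=.
by apply: eq_bigl => s; rewrite /unitZ unitrMr //; apply: prU.
Qed.

(** The numerical form in which the fourth moment is used.  Up to powers of the
    number [t] of divisors of [M], [totient M] is [M] and [P] is at most
    [M ^ (2/3)], so the left-hand side is of order [M ^ 14] and the right-hand
    side of order [M ^ 15].  The exact loss is [t ^ 18]; the divisor bound with
    exponent 36 makes it at most a constant times the square root of [M]. *)
Lemma totient_large (k : nat) : exists C, forall m P, let M := m.+2 in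
  (C < M)%N -> (P ^ 3 <= size (divisors M) ^ 3 * M ^ 2)%N ->
  (k ^ 12 * (M ^ 2 * (3 * (M ^ 2 * P))) ^ 3 <= totient M ^ 15)%N.
Proof.
have [C C_gt0 tauP] := size_divisors_expn_le 36.
exists (27 ^ 2 * k ^ 24 * C)%N => m P M lt_CM leP.
have M_gt0 : (0 < M)%N by [].
have := leq_totient_divisors M_gt0.
have := tauP _ M_gt0; set t := size _ in leP *; set f := totient M => le36 leM.
have t_gt0 : (0 < t)%N.
  by case: (posnP t) leM => // ->; rewrite muln0 leqNgt.
have le18 : (27 * k ^ 12 * t ^ 18 <= M)%N.
  rewrite -(@leq_exp2r _ _ 2) //.
  have -> : ((27 * k ^ 12 * t ^ 18) ^ 2 = 27 ^ 2 * k ^ 24 * t ^ 36)%N by ring.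
  apply: leq_trans (leq_mul (leqnn _) le36) _.
  by rewrite mulnA [(M ^ 2)%N]expnS expn1 leq_mul2r ltnW ?orbT.
rewrite -(@leq_pmul2r (t ^ 15)) ?expn_gt0 ?t_gt0 // -expnMn.
apply: leq_trans (_ : M ^ 15 <= _)%N; last by rewrite leq_exp2r.
apply: leq_trans (_ : (27 * k ^ 12 * t ^ 18) * M ^ 14 <= _)%N; last first.
  by rewrite [(M ^ 15)%N]expnS leq_mul2r le18 orbT.
apply: leq_trans (_ : k ^ 12 * (27 * M ^ 12 * (t ^ 3 * M ^ 2)) * t ^ 15 <= _)%N.
  rewrite leq_mul2r leq_mul2l; apply/orP; right; apply/orP; right.
  apply: leq_trans (leq_mul (leqnn _) leP).
  by apply: eq_leq; clearbody M; ring.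
by apply: eq_leq; clearbody M t; ring.
Qed.

(** Let [M] be [n.+2] divided by the common divisor [g] of [A], [B] and [n.+2].
    If [M] is bounded then it divides a fixed factorial [L], which kills [A] and
    [B].  Otherwise the coprime bound applies to the modulus [M]. *)
Lemma kloosterman_decay (k : nat) : exists2 L : nat, (0 < L)%N &
  forall n z (A B : 'I_n.+2), n.+2.-primitive_root z ->
    k%:R * `|kloosterman z A B| <= #|@unitZ n|%:R \/ A *+ L = 0 /\ B *+ L = 0.
Proof.
have [C largeP] := totient_large k.
exists (C.+1)`! => [|n z A B z_prim]; first exact: fact_gt0.
pose g := gcdn (gcdn A B) n.+2; pose M := (n.+2 %/ g)%N.
have g_gt0 : (0 < g)%N by rewrite gcdn_gt0 orbT.
have NE : (n.+2 = g * M)%N by rewrite mulnC divnK ?dvdn_gcdr.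
have gA : (g %| A)%N by rewrite (dvdn_trans (dvdn_gcdl _ _)) ?dvdn_gcdl.
have gB : (g %| B)%N by rewrite (dvdn_trans (dvdn_gcdl _ _)) ?dvdn_gcdr.
have M_gt0 : (0 < M)%N by case: (posnP M) NE => // ->; rewrite muln0.
have [le_MC | lt_CM] := leqP M C.+1.
  have M_L : (M %| (C.+1)`!)%N by rewrite dvdn_fact // M_gt0.
  have dvdL (c : nat) : (g %| c)%N -> (n.+2 %| c * (C.+1)`!)%N.
    by move=> g_c; rewrite NE dvdn_mul.
  by right; split; apply: val_inj; rewrite Zp_mulrn; apply/eqP/dvdL.
left; case: M lt_CM NE {M_gt0} => [|[|m]] // lt_CM NE.
have lt_div (x : 'I_n.+2) : (x %/ g < m.+2)%N by rewrite ltn_divLR // mulnC -NE.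
pose A' : 'I_m.+2 := Ordinal (lt_div A).
pose B' : 'I_m.+2 := Ordinal (lt_div B).
have AE : A = (g * A')%N :> nat by rewrite mulnC divnK.
have BE : B = (g * B')%N :> nat by rewrite mulnC divnK.
have := kloosterman_reduction z_prim NE AE BE.
set w := z ^+ g => red.
have w_prim : m.+2.-primitive_root w.
  have gE : (n.+2 %/ m.+2 = g)%N by rewrite NE mulnK.
  by rewrite /w -gE; apply: dvdn_prim_root => //; rewrite NE dvdn_mull.
have cop : coprime (gcdn A' B') m.+2.
  rewrite /coprime -(eqn_pmul2l g_gt0) muln1 !muln_gcdr -AE -BE -NE.
  exact: eqxx.
have bound := kloosterman_coprime_bound w_prim cop.
have := largeP m _ (ltnW lt_CM) (card_large_gcd (ltn0Sn _)).
rewrite -card_unitZ -(ler_nat algC); move: bound red.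
set Q := (m.+2 ^ 2 * _)%N; set f := #|@unitZ m|; set K := kloosterman w A' B'.
move=> bound red le_f15.
have f_gt0 : 0 < f%:R :> algC by rewrite ltr0n /f card_unitZ totient_gt0.
have K4 : `|K| ^+ 4 = K ^+ 4.
  by rewrite (exprM _ 2 2) real_normK ?kloosterman_real // -exprM.
have kK_f : k%:R * `|K| <= f%:R.
  rewrite -(@ler_pXn2r _ 12) ?nnegrE ?mulr_ge0 ?ler0n //.
  rewrite -(ler_pM2l (exprn_gt0 3 f_gt0)) -exprD -[X in _ <= X]natrX.
  apply: le_trans le_f15; rewrite natrM natrX.
  have -> : f%:R ^+ 3 * (k%:R * `|K|) ^+ 12 =
            k%:R ^+ 12 * (f%:R * `|K| ^+ 4) ^+ 3.
    by ring.
  rewrite ler_wpM2l ?exprn_ge0 ?ler0n // natrX K4 lerXn2r ?nnegrE ?ler0n //.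
  by rewrite mulr_ge0 ?ler0n // -K4 exprn_ge0.
rewrite -(ler_pM2l f_gt0) mulrCA -[X in X * `|_|](normr_nat _ f) -normrM red.
by rewrite normrM normr_nat mulrCA [X in _ <= X]mulrC ler_wpM2l ?ler0n.
Qed.

(** * Averaging over scales *)

(** Decay fails harmfully at scale [j] only if [L] kills both arguments and one
    of them is nonzero.  The indicator function of this event is at most the sum
    of the increments of [u] and [v] below, whose sums over [j] telescope to at
    most 1 each. *)
Lemma sum_kloosterman_ge (n k L J : nat) (z : algC) (a b : 'I_n.+2) :
  n.+2.-primitive_root z ->
  (forall A B : 'I_n.+2,
    (2 * k)%:R * `|kloosterman z A B| <= #|@unitZ n|%:R
    \/ A *+ L = 0 /\ B *+ L = 0) ->
  - ((4 * k + J) * #|@unitZ n|)%:R <=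
  (2 * k)%:R * \sum_(j < J) kloosterman z (a * L%:R ^+ j) (b * L%:R ^+ (J - j)).
Proof.
move=> z_prim decay; set f := #|@unitZ n|.
pose nz (x : 'I_n.+2) : algC := (x != 0)%:R.
have nz_le1 x : nz x <= 1 by rewrite /nz; case: eqP; rewrite ?ler01.
have nz_ge0 x : 0 <= nz x by rewrite ler0n.
have nzL x : nz (x * L%:R) <= nz x.
  by rewrite /nz; case: (eqVneq x 0) => [->|_];
    rewrite ?mul0r ?eqxx // lern1 leq_b1.
(* In terms of [A] and [B], the two arguments at scale [j], the increments of
   [u] and [v] at [j] are [nz A - nz (A * L)] and [nz B - nz (B * L)]; the index
   [J.+1 - j] makes the increment of [v] start from [B * L]. *)
pose u j := - nz (a * L%:R ^+ j); pose v j := nz (b * L%:R ^+ (J.+1 - j)).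
have uv_ge j : (j < J)%N ->
    - f%:R - (2 * k)%:R * f%:R * ((u j.+1 - u j) + (v j.+1 - v j)) <=
    (2 * k)%:R * kloosterman z (a * L%:R ^+ j) (b * L%:R ^+ (J - j)).
  move=> lt_jJ; rewrite /u /v subSS subSn 1?ltnW // !exprSr !mulrA.
  set A := a * _; set B := b * _; set S := kloosterman _ _ _.
  have Sge : - `|S| <= S.
    by have := lexx `|S|; rewrite real_ler_norml ?kloosterman_real // => /andP[].
  have du_ge0 : 0 <= nz A - nz (A * L%:R) by rewrite subr_ge0.
  have dv_ge0 : 0 <= nz B - nz (B * L%:R) by rewrite subr_ge0.
  rewrite opprK [- nz _ + _]addrC.
  have [le_S | [A0 B0]] := decay A B.
    apply: le_trans (_ : - ((2 * k)%:R * `|S|) <= _); last first.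
      by rewrite -mulrN ler_wpM2l.
    apply: le_trans (_ : - f%:R <= _); last by rewrite lerN2.
    by rewrite gerBl; apply: mulr_ge0 (addr_ge0 du_ge0 dv_ge0);
      rewrite mulr_ge0 ?ler0n.
  have {}A0 : A * L%:R = 0 by rewrite mulr_natr.
  have {}B0 : B * L%:R = 0 by rewrite mulr_natr.
  have nz0 : nz 0 = 0 by rewrite /nz eqxx.
  rewrite A0 B0 nz0 !subr0.
  have [/andP[/eqP A1 /eqP B1] | AB] := boolP ((A == 0) && (B == 0)).
    rewrite /S A1 B1 kloosterman0 nz0 addr0 mulr0 subr0.
    by apply: le_trans (_ : 0 <= _); rewrite ?oppr_le0 ?mulr_ge0 ?ler0n.
  have nzAB : 1 <= nz A + nz B.
    move: AB; rewrite negb_and /nz => /orP[] ->; first by rewrite lerDl ler0n.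
    by rewrite lerDr ler0n.
  apply: le_trans (_ : - ((2 * k)%:R * f%:R) <= _); last first.
    rewrite -mulrN ler_wpM2l ?ler0n // (le_trans _ Sge) // lerN2.
    exact: norm_kloosterman_le.
  rewrite -[X in _ <= X]sub0r lerB ?oppr_le0 ?ler0n //.
  by rewrite -[X in X <= _]mulr1 ler_wpM2l // mulr_ge0 ?ler0n.
rewrite mulr_sumr.
apply: le_trans (_ : \sum_(j < J) (- f%:R - (2 * k)%:R * f%:R *
    ((u j.+1 - u j) + (v j.+1 - v j))) <= _); last first.
  by apply: ler_sum => j _; apply: uv_ge.
rewrite sumrB sumr_const card_ord -mulr_sumr big_split /=.
rewrite -!(big_mkord xpredT (fun j => _ j.+1 - _ j)) !telescope_sumr //.
have du1 : u J - u 0%N <= 1.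
  by rewrite /u opprK addrC lerBlDr (le_trans (nz_le1 _)) // lerDl.
have dv1 : v J - v 0%N <= 1.
  by rewrite /v lerBlDr (le_trans (nz_le1 _)) // lerDl.
have -> : ((4 * k + J) * f)%:R = f%:R *+ J + (2 * k)%:R * f%:R * (1 + 1)
  :> algC.
  by rewrite -mulr_natr !natrM natrD !natrM; ring.
rewrite mulNrn opprD lerD2l lerN2 ler_wpM2l ?lerD //.
by rewrite mulr_ge0 ?ler0n.
Qed.

(** Without a solution, the sum over all frequencies of [w * T], for the weights
    [w] and the Kloosterman sums [T] added over the scales, vanishes.  By
    [sum_kloosterman_ge], [T + c] is nonnegative at every frequency, so the
    frequency [(0, 0)] alone contributes at most the total
    [c * (n.+2 ^ 2 * e)] of [w * (T + c)]; this contradicts the density when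
    [J > 4 * k]. *)
Lemma square_difference_multiple (k : nat) : (0 < k)%N ->
  exists2 D : nat, (0 < D)%N &
    forall n (E1 E2 : {set 'I_n.+2}),
      (n.+2 ^ 2 <= k * (#|E1| * #|E2|))%N ->
      forall t : 'I_n.+2, exists a1 a2 b1 b2,
        [/\ (a1 \in E1) && (a2 \in E1), (b1 \in E2) && (b2 \in E2) &
            (a1 - a2) ^+ 2 - (b1 - b2) ^+ 2 = D%:R * t].
Proof.
move=> k_gt0; have [L L_gt0 decay] := kloosterman_decay (2 * k).
pose J := (4 * k).+1; exists (4 * L ^ J)%N.
  by rewrite muln_gt0 expn_gt0 L_gt0.
move=> n E1 E2 dense t; set f := #|@unitZ n|.
set e := (#|E1| * #|E2|)%N in dense.
have [z z_prim] := C_prim_root_exists (ltn0Sn n.+1).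
pose q j : 'I_n.+2 := L%:R ^+ j.
pose X j (r : 'I_n.+2) := q j * r + q (J - j)%N * t * r^-1.
pose Y j (r : 'I_n.+2) := q (J - j)%N * t * r^-1 - q j * r.
pose Z := 'I_n.+2.
pose sol j (p : (Z * Z) * (Z * Z) * Z) :=
  [&& (p.1.1.1 \in E1) && (p.1.1.2 \in E1)
   && ((p.1.2.1 \in E2) && (p.1.2.2 \in E2)) && unitZ p.2,
   p.1.1.1 - p.1.1.2 == X j p.2 & p.1.2.1 - p.1.2.2 == Y j p.2].
have [/existsP[j /existsP[p]] | no_sol] :=
    boolP [exists j : 'I_J, exists p, sol j p].
  case: p => [[[a1 a2] [b1 b2]] r] /and3P[/= /andP[/andP[aE bE] Ur]].
  move=> /eqP eX /eqP eY.
  exists a1, a2, b1, b2; split=> //; rewrite eX eY /X /Y.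
  have -> : (4 * L ^ J)%N%:R = 4%:R * (q j * q (J - j)%N) :> Z.
    by rewrite natrM natrX -exprD subnKC // ltnW.
  rewrite -[t in RHS]mulr1 -[X in t * X](mulrV Ur); ring.
pose F1 := charsum z (mem E1) id (fun=> 0).
pose F2 := charsum z (mem E2) (fun=> 0) id.
pose K j := charsum z (@unitZ n) (fun r => - X j r) (fun r => - Y j r).
pose w a b := F1 a b * (F1 a b)^* * (F2 a b * (F2 a b)^*).
have sum_wK (j : 'I_J) : \sum_a \sum_b w a b * K j a b = 0.
  under eq_bigr do under eq_bigr do
    rewrite /w /F1 /F2 !(conj_charsum z_prim) !(charsumM z_prim).
  rewrite (sum_charsum z_prim) (eq_card0 (A := [set _ | _])) ?muln0 // => p.
  rewrite inE; apply: contraNF no_sol => h; apply/existsP; exists j.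
  apply/existsP; exists p; move: h; rewrite /sol /=.
  by rewrite !oppr0 !addr0 !add0r !subr_eq0.
have sum_w : \sum_a \sum_b w a b = (n.+2 ^ 2 * e)%:R.
  under eq_bigr do under eq_bigr do
    rewrite /w /F1 /F2 !(conj_charsum z_prim) !(charsumM z_prim).
  pose g (p : Z * Z) := ((p.1, p.1), (p.2, p.2)).
  have gI : injective g by move=> [a b] [a' b'] /pair_equal_spec[[_ ->] [_ ->]].
  rewrite (sum_charsum z_prim) /e -cardsX -(card_imset _ gI); congr (_ * _)%:R.
  apply: eq_card => -[[a a'] [b b']]; rewrite inE /=.
  apply/idP/imsetP => [/and3P[/andP[/andP[aE _] /andP[bE _]]] | [[c d]]].
    rewrite !oppr0 !addr0 !add0r !subr_eq0 => /eqP <- /eqP <-.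
    by exists (a, b) => //; rewrite inE aE.
  rewrite inE => /andP[/= cE dE] [-> -> -> ->].
  by rewrite !oppr0 !addr0 !add0r !subrr eqxx; apply/and3P; split=> //;
    rewrite cE dE.
have w_ge0 a b : 0 <= w a b by rewrite mulr_ge0 ?mul_conjC_ge0.
have F00 (I : finType) (P : pred I) (x y : I -> Z) :
    charsum z P x y 0 0 = #|P|%:R.
  rewrite /charsum; under eq_bigr do rewrite !mul0r addr0 addchar0.
  by rewrite sumr_const.
have w00 : w 0 0 = (e ^ 2)%:R.
  by rewrite /w /F1 /F2 !F00 !conjC_nat -!natrM mulnACA mulnn.
pose T a b := (2 * k)%:R * \sum_(j < J) K j a b.
have T_ge a b : - ((4 * k + J) * f)%:R <= T a b.
  apply: le_trans (sum_kloosterman_ge J (- (a - b)) (- (a + b) * t) z_prim _) _.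
    by move=> A B; apply: decay.
  rewrite /T; set lhs := \sum_(j < J) _; set rhs := \sum_(j < J) _.
  suff -> : lhs = rhs by [].
  apply: eq_bigr => j _; apply: eq_bigr => r _; congr addchar.
  by rewrite /X /Y /q; ring.
have T00 : T 0 0 = (2 * k * (J * f))%:R.
  rewrite /T /K; under eq_bigr do rewrite F00.
  by rewrite sumr_const card_ord !natrM -/f [J%:R * _]mulr_natl.
have sum_wT : \sum_a \sum_b w a b * T a b = 0.
  transitivity ((2 * k)%:R * \sum_(j < J) \sum_a \sum_b w a b * K j a b).
    rewrite [X in _ * X]exchange_big mulr_sumr; apply: eq_bigr => a _ /=.
    rewrite [X in _ * X]exchange_big mulr_sumr; apply: eq_bigr => b _ /=.
    by rewrite -mulr_sumr mulrCA.
  by rewrite big1 ?mulr0.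
have f_gt0 : (0 < f)%N by rewrite /f card_unitZ totient_gt0.
have e_gt0 : (0 < e)%N.
  by case: (posnP e) dense => // ->; rewrite muln0.
pose c := ((4 * k + J) * f)%N.
have : \sum_a \sum_b w a b * (T a b + c%:R) = (c * (n.+2 ^ 2 * e))%:R.
  transitivity (\sum_a \sum_b w a b * T a b + c%:R * \sum_a \sum_b w a b).
    rewrite mulr_sumr -big_split; apply: eq_bigr => a _ /=.
    rewrite mulr_sumr -big_split; apply: eq_bigr => b _ /=.
    by rewrite mulrDr [c%:R * _]mulrC.
  by rewrite sum_wT sum_w add0r -natrM.
have wT_ge0 a b : 0 <= w a b * (T a b + c%:R).
  by rewrite mulr_ge0 // -lerBlDr sub0r T_ge.
move=> sum_eq; have : w 0 0 * (T 0 0 + c%:R) <= (c * (n.+2 ^ 2 * e))%:R.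
  rewrite -sum_eq (bigD1 0) //= (bigD1 0) //= -addrA lerDl addr_ge0 //.
    by apply: sumr_ge0.
  by apply: sumr_ge0 => a _; apply: sumr_ge0.
rewrite w00 T00 -natrD -natrM ler_nat leqNgt => /negP[].
apply: leq_ltn_trans (_ : c * (k * e * e) < _)%N.
  by rewrite leq_mul2l leq_mul2r dense !orbT.
rewrite [X in (X < _)%N](_ : _ = e ^ 2 * (c * k))%N; last by ring.
rewrite ltn_pmul2l ?expn_gt0 ?e_gt0 // /c /J.
rewrite [X in (X < _)%N](_ : _ = f * ((8 * k + 1) * k))%N; last by ring.
rewrite [X in (_ < X)%N](_ : _ = f * (2 * k * (4 * k + 1) + (8 * k + 1)))%N;
  last by ring.
by rewrite ltn_pmul2l //; nia.
Qed.

(** * Differences of squares in dense sets *)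

Lemma dense_nat_bound (R : realType) (alpha : R) : 0 < alpha ->
  exists2 k : nat, (0 < k)%N &
    forall N s : nat, alpha * N%:R <= s%:R -> (N <= k * s)%N.
Proof.
move=> a_gt0; exists (Num.bound alpha^-1).
  by rewrite -(ltr_nat R) (le_lt_trans _ (archi_boundP _)) ?invr_ge0 ?ltW.
move=> N s le_s; rewrite -(ler_nat R) natrM -[N%:R](mulKf (lt0r_neq0 a_gt0)).
apply: ler_pM => //; rewrite ?invr_ge0 ?mulr_ge0 ?ler0n ?(ltW a_gt0) //.
by rewrite ltW // archi_boundP // invr_ge0 ltW.
Qed.

(** [D] and [gcdn D n.+1] have the same multiples modulo [n.+1], by Bezout. *)
Lemma dilate_full_gcd (n D : nat) (x : 'I_n.+1) : exists t : 'I_n.+1,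
  x *+ gcdn D n.+1 = t *+ D.
Proof.
have [u _ /dvdnP[v uv]] := Bezoutr D (ltn0Sn n).
exists (- (x *+ u)); rewrite mulNrn -mulrnA.
apply/eqP; rewrite -addr_eq0 -mulrnDr uv mulrnA.
by apply/eqP/val_inj; rewrite Zp_mulrn /= modnMl.
Qed.

Theorem corollary1p10 (R : realType) (alpha beta : R)
    (alpha_gt0 : 0 < alpha) (beta_gt0 : 0 < beta) :
  exists K : nat, (1 <= K)%N /\
    forall (n : nat) (E1 E2 : {set 'I_n.+1}),
      alpha * n.+1%:R <= #|E1|%:R ->
      beta * n.+1%:R <= #|E2|%:R ->
      exists d : nat,
        [/\ (0 < d)%N, (d %| n.+1)%N, (d <= K)%N &
            dilate_full n d \subset
              diff_set (square_set (diff_set E1 E1))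
                       (square_set (diff_set E2 E2))].
Proof.
have [k1 k1_gt0 E1P] := dense_nat_bound alpha_gt0.
have [k2 k2_gt0 E2P] := dense_nat_bound beta_gt0.
have k_gt0 : (0 < k1 * k2)%N by rewrite muln_gt0 k1_gt0.
have [D D_gt0 solve] := square_difference_multiple k_gt0.
exists D; split=> // n E1 E2 /E1P dense1 /E2P dense2.
exists (gcdn D n.+1); split; rewrite ?gcdn_gt0 ?orbT ?dvdn_gcdr //.
  by rewrite dvdn_leq ?dvdn_gcdl.
apply/subsetP => _ /imsetP[x _ ->]; have [t ->] := dilate_full_gcd D x.
suff [a1 [a2 [b1 [b2 [/andP[a1E a2E] /andP[b1E b2E] ab]]]]] :
    exists a1 a2 b1 b2 : 'I_n.+1,
      [/\ (a1 \in E1) && (a2 \in E1), (b1 \in E2) && (b2 \in E2) &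
       Zp_mul (a1 - a2) (a1 - a2) - Zp_mul (b1 - b2) (b1 - b2) = t *+ D].
  by rewrite -ab; apply: imset2_f; apply: imset_f; apply: imset2_f.
(* Only for moduli at least 2 do the ordinals form a ring; modulo 1 all
   elements are equal. *)
case: n E1 E2 {x} t dense1 dense2 => [|n] E1 E2 t dense1 dense2.
  have [a aE] : exists a, a \in E1.
    by apply/set0Pn; rewrite -card_gt0; case: #|_| dense1 => //; rewrite muln0.
  have [b bE] : exists b, b \in E2.
    by apply/set0Pn; rewrite -card_gt0; case: #|_| dense2 => //; rewrite muln0.
  by exists a, a, b, b; rewrite aE bE; split=> //; rewrite [LHS]ord1 [RHS]ord1.
have dense : (n.+2 ^ 2 <= k1 * k2 * (#|E1| * #|E2|))%N.
  by rewrite mulnACA expnS expn1 leq_mul.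
have [a1 [a2 [b1 [b2 [aE bE ab]]]]] := solve n E1 E2 dense t.
exists a1, a2, b1, b2; split=> //.
by rewrite -mulr_natl -ab !expr2.
Qed.
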